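(* Let $k\ge 1$, let $\lambda=(\lambda_1\ge\dots\ge\lambda_k\ge 0)$ be an integer partition with at most $k$ parts, and let $n=k+\lambda_1$. Then the double Schur polynomial $s_\lambda(x_1,\dots,x_k\,|\,y)$ can be computed by a subtraction-free arithmetic circuit of size $O(n^3)$ (with an absolute implied constant, uniformly in $k$ and $\lambda$). The bit complexity of the corresponding algorithm is $O(n^3\log^2 n)$.
   Context: Subtraction-free circuits: an arithmetic circuit is a directed acyclic network whose gates each perform one binary arithmetic operation; its inputs are the variables and arbitrary positive integer scalars, and it outputs a rational function in the variables. It is subtraction-free if every gate is an addition, a multiplication or a division (no subtraction gates, no negative scalars). The size of a circuit is its number of gates. Bit complexity: for this purpose the input variables are viewed as numbers rather than formal variables; the bit complexity of the algorithm is the total bit cost of computing its initial values, of generating the sequence of arithmetic steps to be performed, and of performing these steps, where the numbers involved are taken to have bit size logarithmic in $n$. Double Schur polynomials: let $x_1,x_2,\dots$ and $y_1,y_2,\dots$ be formal variables. Let $Z=(Z_{ij})_{i,j=1}^n$ be the $n\times n$ matrix with $$Z_{ij}=\frac{\prod_{1\le b<i}(x_j+y_b)}{\prod_{1\le a<j}(x_j-x_a)}.$$ For a partition $\lambda=(\lambda_1,\dots,\lambda_k)$ with at most $k$ parts and $\lambda_1+k\le n$, put $I(\lambda)=\{\lambda_k+1,\lambda_{k-1}+2,\dots,\lambda_1+k\}\subset\{1,\dots,n\}$. The double Schur polynomial is $$s_\lambda(x_1,\dots,x_k\,|\,y)=\det(Z_{ij})_{i\in I(\lambda),\,1\le j\le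 k},$$ a polynomial in $x_1,\dots,x_k$ and $y_1,\dots,y_{k+\lambda_1-1}$. *)

(* Defs.v *)
From HB Require Import structures.
From mathcomp Require Import all_boot all_order all_algebra.
From mathcomp Require Import mpoly.

Set Implicit Arguments.
Unset Strict Implicit.
Unset Printing Implicit Defensive.

Import GRing.Theory.

(* All indices are shifted to start at 0: [x j], [y b], the rows and columns of
   [Z] and the parts of [lam] are x_{j+1}, y_{b+1}, etc. in 1-based notation.  *)

Section DoubleSchur.
Local Open Scope ring_scope.

Definition Zentry (F : fieldType) (x y : nat -> F) (i j : nat) : F :=
  (\prod_(b < i) (x j + y b)) / \prod_(a < j) (x j - x a).

(* The i-th smallest element of I(lam) (k = size lam); for a weakly decreasing
   lam these are strictly increasing in i.                                     *)
Definition Iset (lam : seq nat) (i : nat) : nat :=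
  (nth 0 lam (size lam - i.+1) + i)%N.

Definition double_schur (F : fieldType) (lam : seq nat) (x y : nat -> F) : F :=
  \det (\matrix_(i < size lam, j < size lam) Zentry x y (Iset lam i) j).

(* The i-th of N formal variables, as a rational function; the value 0 for
   i >= N is a dummy.                                                          *)
Definition fvar (N i : nat) : {fraction {mpoly int[N]}} :=
  if insub i is Some j then tofrac 'X_j else 0.

End DoubleSchur.

Inductive arith := Add | Sub | Mul | Div.

Inductive source := VarX | VarY | Scalar | Gate.

(* [(VarX, j)] is x j, [(VarY, b)] is y b, [(Scalar, c)] is the integer c and
   [(Gate, g)] is the output of the gate number g.                             *)
Definition operand := (source * nat)%type.

Record gate := MkGate { gop : arith; garg1 : operand; garg2 : operand }.

(* The gates are listed in a topological order of the network: a gate may only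
   refer to earlier ones (otherwise evaluation fails).                         *)
Record circuit := MkCircuit { gates : seq gate; output : operand }.

Definition circuit_size (c : circuit) : nat := size (gates c).

Definition operands (c : circuit) : seq operand :=
  output c :: flatten [seq [:: garg1 g; garg2 g] | g <- gates c].

Definition subtraction_free (c : circuit) : bool :=
  all (fun g => if gop g is Sub then false else true) (gates c)
  && all (fun o : operand => if o.1 is Scalar then 0 < o.2 else true)
         (operands c).

(* The only variables read by the circuit are x 0, ..., x (p - 1) and
   y 0, ..., y (q - 1).                                                        *)
Definition inputs_in (p q : nat) (c : circuit) : bool :=
  all (fun o : operand =>
         match o.1 with VarX => o.2 < p | VarY => o.2 < q | _ => true end)
      (operands c).

Section Evaluation.
Local Open Scope ring_scope.
Variables (F : fieldType) (x y : nat -> F).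

Definition eval_operand (vals : seq F) (o : operand) : option F :=
  match o.1 with
  | VarX => Some (x o.2)
  | VarY => Some (y o.2)
  | Scalar => Some (o.2%:R)
  | Gate => onth vals o.2
  end.

Definition eval_arith (op : arith) (u v : F) : option F :=
  match op with
  | Add => Some (u + v)
  | Sub => Some (u - v)
  | Mul => Some (u * v)
  | Div => if v == 0 then None else Some (u / v)
  end.

Definition eval_gate (vals : seq F) (g : gate) : option F :=
  obind (fun u => obind (eval_arith (gop g) u) (eval_operand vals (garg2 g)))
        (eval_operand vals (garg1 g)).

Fixpoint eval_gates (vals : seq F) (gs : seq gate) : option (seq F) :=
  if gs is g :: gs' then
    obind (fun v => eval_gates (rcons vals v) gs') (eval_gate vals g)
  else Some vals.

Definition eval_circuit (c : circuit) : option F :=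
  obind (fun vals => eval_operand vals (output c)) (eval_gates [::] (gates c)).

End Evaluation.

Definition bitlen (m : nat) : nat := (trunc_log 2 m).+1.

(* Schoolbook bit cost of one operation on numbers of a and b bits. *)
Definition arith_cost (op : arith) (a b : nat) : nat :=
  match op with Add | Sub => a + b | Mul | Div => a * b end.

(* Bit cost of performing all the steps of a circuit when every number involved
   is taken to have L bits.                                                    *)
Definition perform_cost (L : nat) (c : circuit) : nat :=
  \sum_(g <- gates c) arith_cost (gop g) L L.

(* Algorithms are programs for a random access machine with logarithmic costs,
   whose output is a circuit, written gate by gate.  The memory consists of
   unbounded arrays of natural numbers; the names of the arrays are literals of
   the program, so a given program uses a fixed finite number of them.  In
   expressions, [Sub] is truncated and [Div] is Euclidean.                     *)
Inductive expr :=
  | Lit of nat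
  | Get of nat & expr
  | Op of arith & expr & expr.

Inductive cmd :=
  | Seq of cmd & cmd
  | Store of nat & expr & expr
  | If of expr & cmd & cmd
  | While of expr & cmd
  | Emit of arith & source & expr & source & expr
  | Output of source & expr.

Definition memory := nat -> nat -> nat.

Definition update (m : memory) (a i v : nat) : memory :=
  fun a' i' => if (a' == a) && (i' == i) then v else m a' i'.

Definition nat_arith (op : arith) (u v : nat) : nat :=
  match op with
  | Add => u + v | Sub => u - v | Mul => u * v | Div => u %/ v
  end.

Fixpoint eval (m : memory) (e : expr) : nat :=
  match e with
  | Lit v => v
  | Get a e1 => m a (eval m e1)
  | Op op e1 e2 => nat_arith op (eval m e1) (eval m e2)
  end.

Fixpoint ecost (m : memory) (e : expr) : nat :=
  match e with
  | Lit v => bitlen v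
  | Get a e1 => ecost m e1 + bitlen (eval m e1) + bitlen (eval m e)
  | Op op e1 e2 =>
      ecost m e1 + ecost m e2
      + arith_cost op (bitlen (eval m e1)) (bitlen (eval m e2))
  end.

Definition emit (c : circuit) (g : gate) : circuit :=
  MkCircuit (rcons (gates c) g) (output c).

Definition set_output (c : circuit) (o : operand) : circuit :=
  MkCircuit (gates c) o.

(* [exec p (m, c) t (m', c')]: started with memory m and partial circuit c, the
   program p halts with memory m' and circuit c' after spending t bit operations.
   Conditions hold when they evaluate to a nonzero number.  Emitting a gate is
   charged for the sizes of its two operand labels and of its own number.      *)
Inductive exec : cmd -> memory * circuit -> nat -> memory * circuit -> Prop :=
  | ExecSeq p q s1 t1 s2 t2 s3 :
      exec p s1 t1 s2 -> exec q s2 t2 s3 -> exec (Seq p q) s1 (t1 + t2) s3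
  | ExecStore a e1 e2 m c :
      exec (Store a e1 e2) (m, c)
           (ecost m e1 + ecost m e2 + bitlen (eval m e1) + bitlen (eval m e2))
           (update m a (eval m e1) (eval m e2), c)
  | ExecIfTrue e p q m c t s :
      eval m e != 0 -> exec p (m, c) t s ->
      exec (If e p q) (m, c) (ecost m e + bitlen (eval m e) + t) s
  | ExecIfFalse e p q m c t s :
      eval m e = 0 -> exec q (m, c) t s ->
      exec (If e p q) (m, c) (ecost m e + bitlen (eval m e) + t) s
  | ExecWhileTrue e p m c t1 s t2 s' :
      eval m e != 0 -> exec p (m, c) t1 s -> exec (While e p) s t2 s' ->
      exec (While e p) (m, c) (ecost m e + bitlen (eval m e) + t1 + t2) s'
  | ExecWhileFalse e p m c :
      eval m e = 0 ->
      exec (While e p) (m, c) (ecost m e + bitlen (eval m e)) (m, c)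
  | ExecEmit op s1 e1 s2 e2 m c :
      exec (Emit op s1 e1 s2 e2) (m, c)
           (ecost m e1 + ecost m e2 + bitlen (eval m e1) + bitlen (eval m e2)
            + bitlen (circuit_size c))
           (m, emit c (MkGate op (s1, eval m e1) (s2, eval m e2)))
  | ExecOutput s e m c :
      exec (Output s e) (m, c) (ecost m e + bitlen (eval m e))
           (m, set_output c (s, eval m e)).

(* The input: cell 0 of array 0 holds k = size lam, array 1 holds the parts of
   lam, and all other cells are 0.                                             *)
Definition input_memory (lam : seq nat) : memory :=
  fun a i => match a, i with
             | 0, 0 => size lam
             | 1, _ => nth 0 lam i
             | _, _ => 0
             end.

(* The initial output operand is a dummy: it refers to a nonexistent gate. *)
Definition empty_circuit : circuit := MkCircuit [::] (Gate, 0).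

(* On input lam, the program p halts and outputs the circuit c, the generation of
   which costs t bit operations.                                               *)
Definition generates (p : cmd) (lam : seq nat) (t : nat) (c : circuit) : Prop :=
  exists m, exec p (input_memory lam, empty_circuit) t (m, c).

(* Main.v *)
(* Write n = k + lambda_1.  Start from the rows 1, 2, ..., n of Z and delete the
   elements of the complement of I(lambda) one at a time, in increasing order.
   After j deletions let T(j, r, m) be the minor of Z with m consecutive remaining
   rows starting at the r-th one, and columns 1, ..., m.
   Counting from 0, for j = 0 this is prod_{c < m, b < r} (x_c + y_b), by Vandermonde.  If the
   (j+1)-st deleted row does not lie strictly inside the window of T(j+1, r, m),
   then this minor is T(j, r, m) or T(j, r+1, m); otherwise the three-term Pluecker
   relation expresses it, without subtraction, as
     (T(j+1, r, m-1) T(j, r+1, m) + T(j+1, r+1, m-1) T(j, r, m)) / T(j, r+1, m-1).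
   The double Schur polynomial is T(lambda_1, 0, k), and the table has O(n^3)
   entries.  No divisor vanishes, since every value computed without subtraction is
   a quotient of polynomials that are positive at (1, ..., 1).
   Each entry gets exactly four gates, so all gate numbers are explicit functions of
   (j, r, m) and a single loop writes the circuit down. *)
Require Import Defs.
From mathcomp Require Import all_boot all_order all_algebra.
From mathcomp Require Import mpoly.
From mathcomp Require Import zify ring.

Set Implicit Arguments.
Unset Strict Implicit.
Unset Printing Implicit Defensive.

(* [eqtype.Sub] shadows the constructor [Sub]. *)
Import Defs GRing.Theory.

(** * The three-term Pluecker relation *)

Section Minors.
Local Open Scope ring_scope.
Variable R : comNzRingType.
Implicit Type g : nat -> nat -> R.

Definition lead_minor m g : R := \det (\matrix_(i < m, j < m) g i j).

Lemma eq_lead_minor m g h :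
  (forall i, (i < m)%N -> g i =1 h i) -> lead_minor m g = lead_minor m h.
Proof.
move=> eq_gh; congr (\det _); apply/matrixP=> i j.
by rewrite !mxE eq_gh.
Qed.

(** The cofactor of the entry in column [b] of an extra row placed on top of [g]. *)
Definition insertion_coef m g (b : nat) : R :=
  (-1) ^+ b * lead_minor m (fun i j => g i (bump b j)).

(* The determinant of the row [v] followed by the first [m] rows of [g]. *)
Definition insertion m g (v : nat -> R) : R :=
  \sum_(b < m.+1) v b * insertion_coef m g b.

Lemma eq_insertion m g h v :
  (forall i, (i < m)%N -> g i =1 h i) -> insertion m g v = insertion m h v.
Proof.
move=> eq_gh; apply: eq_bigr => b _; congr (_ * (_ * _)).
by apply: eq_lead_minor => i /eq_gh eq_i j.
Qed.

(** Laplace expansion along row [q]; moving that row to the top costs the sign. *)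
Lemma lead_minor_insertion m g q : (q <= m)%N ->
  lead_minor m.+1 g = (-1) ^+ q * insertion m (fun i => g (bump q i)) (g q).
Proof.
move=> le_qm; rewrite /lead_minor (expand_det_row _ (Ordinal (le_qm : q < m.+1)%N)).
rewrite mulr_sumr; apply: eq_bigr => b _; rewrite mxE /cofactor /= exprD.
rewrite [RHS]mulrCA -!mulrA; congr (_ * (_ * (_ * _))).
by congr (\det _); apply/matrixP=> i j; rewrite !mxE.
Qed.

Lemma insertion_row m g i : (i < m)%N -> insertion m g (g i) = 0.
Proof.
move=> lt_im.
have := @lead_minor_insertion m (fun a => if a is a'.+1 then g a' else g i) 0 isT.
rewrite expr0 mul1r /= => <-; rewrite /lead_minor.
apply: (@determinant_alternate _ _ _ ord0 (lift ord0 (Ordinal lt_im))) => // j.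
by rewrite !mxE.
Qed.

(** Expand along its first column the determinant in which column [b] is repeated in front. *)
Lemma lead_minor_column m g b : (b < m)%N ->
  \sum_(a < m.+1) (-1) ^+ a * g a b * lead_minor m (fun i => g (bump a i)) = 0.
Proof.
move=> lt_bm.
pose A := \matrix_(i < m.+1, j < m.+1) (if j : nat is j'.+1 then g i j' else g i b).
have detA : \det A = 0.
  rewrite -det_tr.
  apply: (@determinant_alternate _ _ _ ord0 (lift ord0 (Ordinal lt_bm))) => // i.
  by rewrite !mxE.
rewrite -[RHS]detA (expand_det_col _ ord0); apply: eq_bigr => a _.
rewrite /cofactor mxE /= addn0 mulrA [_ * g a b]mulrC; congr (_ * \det _).
by apply/matrixP => i j; rewrite !mxE.
Qed.

(* [insertion m G] is a linear form in the first m+1 entries of its argument,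
   so this sum is a combination of determinants with a repeated column. *)
Lemma insertion_relation m g G :
  \sum_(a < m.+3) (-1) ^+ a * insertion m G (g a)
     * lead_minor m.+2 (fun i => g (bump a i)) = 0.
Proof.
under eq_bigr => a _ do rewrite /insertion -mulrA mulr_suml mulr_sumr.
rewrite exchange_big /= big1 // => b _.
have lt_b : (b < m.+2)%N by rewrite ltnW // ltnS ltn_ord.
rewrite -[RHS](mulr0 (insertion_coef m G b)) -[X in _ = _ * X](lead_minor_column g lt_b) mulr_sumr.
by apply: eq_bigr => a _; ring.
Qed.

(** In [insertion_relation], let [G] consist of the rows of the window other than its first, its
    last and row [p]. Inserting a row of [G] into [G] gives 0, so only these three rows
    contribute. *)
Theorem three_term_plucker m g p : (0 < p < m)%N ->
  lead_minor m.-1 (fun i => g i.+1) * lead_minor m (fun i => g (bump p i)) =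
  lead_minor m.-1 (fun i => g (bump p i)) * lead_minor m (fun i => g i.+1)
  + lead_minor m.-1 (fun i => g (bump p i.+1)) * lead_minor m g.
Proof.
case: m => [|[|m]]; [by case: p|by case: p => [|[]] |].
case: p => // p /= lt_pm; have {lt_pm} le_pm : (p <= m)%N by [].
pose G i := g (bump p.+1 i.+1).
have := insertion_relation m g G.
have lt0 : (0 < m.+3)%N by [].
have ltp : (p.+1 < m.+3)%N by lia.
have ltm : (m.+2 < m.+3)%N by [].
rewrite (bigD1 (Ordinal lt0)) //= (bigD1 (Ordinal ltp)) //= (bigD1 (Ordinal ltm)) /=; last first.
  by rewrite -!val_eqE /= eqSS gtn_eqF // ltnS.
rewrite big1 ?addr0 => [|[i lti]]; last first.
  rewrite -!val_eqE /= => /andP[/andP[i0 ip] im].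
  (* The position of row [i] within [G]: the predecessor accounts for row 0, [unbump p] for row
     [p.+1]. *)
  pose i' := unbump p i.-1.
  have -> : g i = G i'.
    by rewrite /G /i' /bump /unbump; congr g; move: i0 ip; case: ltnP; lia.
  rewrite insertion_row ?mulr0 ?mul0r //.
  by rewrite /i' /unbump; case: ltnP; lia.
rewrite expr0 mul1r.
(* Each smaller minor is [G] with one of the rows [p.+1], 0, [m.+2] inserted, at position [p], first
   and last respectively. *)
rewrite (@lead_minor_insertion m (fun i => g i.+1) p) //.
rewrite (@lead_minor_insertion m (fun i => g (bump p.+1 i)) 0) // expr0 mul1r.
rewrite (@lead_minor_insertion m (fun i => g (bump p.+1 i.+1)) m) //.
rewrite (_ : g (bump p.+1 0) = g 0) //.
rewrite (_ : g (bump p.+1 m.+1) = g m.+2); last by rewrite /bump ltnS le_pm.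
rewrite (_ : insertion m (fun i => g (bump p i).+1) _ = insertion m G (g p.+1)); last first.
  by apply: eq_insertion => i _ j; congr g; rewrite /bump; lia.
rewrite (_ : insertion m (fun i => g (bump p.+1 (bump m i).+1)) _
           = insertion m G (g m.+2)); last first.
  by apply: eq_insertion => i lt_im j; congr g; rewrite /bump; lia.
rewrite (_ : lead_minor m.+2 (fun i => g (bump m.+2 i)) = lead_minor m.+2 g); last first.
  by apply: eq_lead_minor => i lt_im j; congr g; rewrite /bump; lia.
rewrite (_ : lead_minor m.+2 (fun i => g (bump 0 i)) = lead_minor m.+2 (fun i => g i.+1)) //.
rewrite (_ : insertion m (fun i => g (bump p.+1 (bump 0 i))) (g 0) = insertion m G (g 0)) //.
rewrite !exprS => rel; apply/eqP; rewrite -subr_eq0 -oppr_eq0 -[X in _ == X]rel; apply/eqP; ring.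
Qed.

End Minors.

(** * Minors of Z along the deletion process *)

Section Stages.
Local Open Scope ring_scope.
Variables (F : fieldType) (x y : nat -> F).

(** The matrix of values is the coefficient matrix, unitriangular since [q i] is monic of degree
    [i], times the Vandermonde matrix. *)
Lemma det_monic_Vandermonde m (q : nat -> {poly F}) :
  (forall i, q i \is monic) -> (forall i, size (q i) = i.+1) ->
  lead_minor m (fun i j => (q i).[x j])
  = \prod_(j < m) \prod_(a < j) (x j - x a).
Proof.
move=> q_monic size_q.
pose L := \matrix_(i < m, l < m) (q i)`_l.
pose V := Vandermonde m (\row_(j < m) x j).
have -> : lead_minor m (fun i j => (q i).[x j]) = \det (L *m V).
  congr (\det _); apply/matrixP=> i j; rewrite !mxE.
  rewrite (@horner_coef_wide _ m) ?size_q //.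
  by apply: eq_bigr => l _; rewrite !mxE.
rewrite det_mulmx det_trig; last first.
  by apply/is_trig_mxP => i l lt_il; rewrite mxE nth_default // size_q.
rewrite big1 ?mul1r => [|i _]; last first.
  by rewrite mxE; have /monicP := q_monic i; rewrite lead_coefE size_q.
rewrite det_Vandermonde (exchange_big_dep xpredT) //=; apply: eq_bigr => j _.
rewrite [RHS](big_ord_widen m (fun a => x j - x a) (ltnW (ltn_ord j))).
by apply: eq_bigr => i _; rewrite !mxE.
Qed.

Lemma lead_minor_scale m (c : nat -> F) (g : nat -> nat -> F) :
  lead_minor m (fun i j => g i j * c j) = lead_minor m g * \prod_(j < m) c j.
Proof.
have -> : \prod_(j < m) c j = \det (diag_mx (\row_(j < m) c j)).
  by rewrite det_diag; apply: eq_bigr => j _; rewrite mxE.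
rewrite -det_mulmx; congr (\det _); apply/matrixP => i j.
by rewrite mul_mx_diag !mxE.
Qed.

(** Taking the factor [c j] out of column [j] leaves in row [i] a monic polynomial of degree [i] at
    [x j]. The resulting Vandermonde product cancels the denominators of the [c j]. *)
Lemma interval_minor_Zentry r m :
  (forall a j, (a < j)%N -> (j < m)%N -> x j != x a) ->
  lead_minor m (fun i => Zentry x y (r + i))
  = \prod_(j < m) \prod_(b < r) (x j + y b).
Proof.
move=> x_neq.
pose q i : {poly F} := \prod_(b < i) ('X + (y (r + b))%:P).
have q_monic i : q i \is monic by apply: monic_prod => b _; apply: monicXaddC.
have size_q i : size (q i) = i.+1.
  rewrite size_prod => [|b _]; last exact/monic_neq0/monicXaddC.
  under eq_bigr => b _ do rewrite size_XaddC.
  by rewrite sum_nat_const card_ord muln2 -addnn subSn ?leq_addl // addnK.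
pose c j := (\prod_(b < r) (x j + y b)) / \prod_(a < j) (x j - x a).
have -> : lead_minor m (fun i => Zentry x y (r + i))
        = lead_minor m (fun i j => (q i).[x j] * c j).
  apply: eq_lead_minor => i _ j; rewrite /Zentry /c mulrA; congr (_ / _).
  rewrite big_split_ord /= mulrC horner_prod; congr (_ * _).
  by apply: eq_bigr => b _; rewrite !hornerE.
rewrite lead_minor_scale det_monic_Vandermonde // -big_split /=.
apply: eq_bigr => j _; rewrite mulrC divfK //.
by apply/prodf_neq0 => a _; rewrite subr_eq0 x_neq.
Qed.

Variable lam : seq nat.
Hypothesis lam_sorted : sorted geq lam.

(* Starting from the rows 0, 1, 2, ..., step [j] deletes the [j]-th element of
   the complement of I(lam); [row_index j i] is the [i]-th row that is left
   after [j] steps. *)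
Definition row_index (j i : nat) : nat :=
  (i + minn j (nth 0 lam ((size lam).-1 - i)))%N.

(** This is T(j, r, m). For [i >= size lam] the truncated subtraction in [row_index] selects the
    largest part, the right shift for rows beyond I(lam). *)
Definition stage_minor (j r m : nat) : F :=
  lead_minor m (fun i => Zentry x y (row_index j (r + i))).

Lemma nth_part_le i j : (i <= j)%N -> (nth 0 lam j <= nth 0 lam i)%N.
Proof.
move=> le_ij; have [lt_j|le_j] := ltnP j (size lam); last by rewrite nth_default.
have geq_trans : transitive geq by move=> b a c /= ab bc; apply: leq_trans bc ab.
apply: (sorted_leq_nth geq_trans (fun a => leqnn a) 0 lam_sorted) => //.
by rewrite inE (leq_ltn_trans le_ij).
Qed.

Lemma stage_minor0 r m :
  (forall a j, (a < j)%N -> (j < m)%N -> x j != x a) ->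
  stage_minor 0 r m = \prod_(j < m) \prod_(b < r) (x j + y b).
Proof.
move=> x_neq; rewrite -(interval_minor_Zentry _ x_neq).
by apply: eq_lead_minor => i _ j; rewrite /row_index min0n addn0.
Qed.

Lemma stage_minor_full :
  stage_minor (nth 0 lam 0) 0 (size lam) = double_schur lam x y.
Proof.
congr (\det _); apply/matrixP => i j; rewrite !mxE /row_index /Iset add0n.
congr (Zentry _ _ _ _); rewrite addnC subnS -subn1 subnAC subn1.
by congr (_ + _)%N; apply/minn_idPr/nth_part_le.
Qed.

(** The deleted row has position at most [r], so every row of the window moves up by one
    position. *)
Lemma stage_minor_after j r m :
  (j < nth 0 lam ((size lam).-1 - r))%N ->
  stage_minor j.+1 r m = stage_minor j r.+1 m.
Proof.
move=> lt_j; apply: eq_lead_minor => i _ c; congr (Zentry _ _ _ _).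
have le_i : (nth 0 lam ((size lam).-1 - r) <= nth 0 lam ((size lam).-1 - (r + i)))%N.
  by apply: nth_part_le; lia.
have le_i1 : (nth 0 lam ((size lam).-1 - r) <= nth 0 lam ((size lam).-1 - (r.+1 + i)))%N.
  by apply: nth_part_le; lia.
by rewrite /row_index; lia.
Qed.

(** The deleted row comes after the last row of the window, number [r + m - 1], and the rows before
    it keep their positions. *)
Lemma stage_minor_before j r m :
  (0 < m -> nth 0 lam (size lam - r - m) <= j)%N ->
  stage_minor j.+1 r m = stage_minor j r m.
Proof.
move=> le_j; apply: eq_lead_minor => i lt_im c; congr (Zentry _ _ _ _).
have le_i : (nth 0 lam ((size lam).-1 - (r + i)) <= nth 0 lam (size lam - r - m))%N.
  by apply: nth_part_le; lia.
by rewrite /row_index; move: (le_j (leq_ltn_trans (leq0n _) lt_im)) => ?; lia.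
Qed.

(** The deleted row has a position [p] with [r < p < r + m], and the Pluecker relation applies to
    the [m.+1] rows of stage [j] starting at [r]. The bound [1 < m] ensures that the smaller minors
    are nonempty. *)
Lemma stage_minor_across j r m : (0 < m)%N ->
  (nth 0 lam ((size lam).-1 - r) <= j < nth 0 lam (size lam - r - m))%N ->
  (1 < m)%N /\
  stage_minor j r.+1 m.-1 * stage_minor j.+1 r m =
  stage_minor j.+1 r m.-1 * stage_minor j r.+1 m
  + stage_minor j.+1 r.+1 m.-1 * stage_minor j r m.
Proof.
move=> m_gt0 /andP[le_j lt_j].
have exP : exists i, (j < nth 0 lam ((size lam).-1 - i))%N.
  (* The last row of the window is already shifted by this deletion. *)
  by exists (r + m.-1)%N; rewrite (_ : _ - _ = size lam - r - m)%N //; lia.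
have [p lt_p min_p] := ex_minnP exP.
have small i : (i < p)%N -> (nth 0 lam ((size lam).-1 - i) <= j)%N.
  by move=> lt_ip; rewrite leqNgt; apply: contraL lt_ip => /min_p; rewrite leqNgt.
have large i : (p <= i)%N -> (j < nth 0 lam ((size lam).-1 - i))%N.
  by move=> le_pi; apply: leq_trans lt_p (nth_part_le (leq_sub2l _ le_pi)).
have lt_rp : (r < p)%N.
  by rewrite ltnNge; apply/negP => /large; rewrite ltnNge le_j.
have lt_pm : (p < r + m)%N.
  rewrite ltnNge; apply/negP => le_p.
  have /small : (r + m.-1 < p)%N by lia.
  rewrite (_ : _ - _ = size lam - r - m)%N; last by lia.
  by rewrite leqNgt lt_j.
(* Step [j] removes exactly row [p] of the current list. *)
have step i : row_index j.+1 i = row_index j (bump p i).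
  rewrite /row_index /bump; case: (leqP p i) => [le_pi | lt_ip].
    by rewrite add1n; have := large _ le_pi; have := large i.+1 (leqW le_pi); lia.
  rewrite add0n; have := small _ lt_ip; lia.
have step_r i : row_index j.+1 (r + i) = row_index j (r + bump (p - r) i).
  by rewrite step; congr row_index; rewrite /bump; lia.
split; first by lia.
have := @three_term_plucker _ m (fun i => Zentry x y (row_index j (r + i))) (p - r).
rewrite /stage_minor => plucker.
have shift s i : row_index s (r.+1 + i) = row_index s (r + i.+1).
  by rewrite addSnnS.
have S1 s d : lead_minor d (fun i => Zentry x y (row_index s (r.+1 + i)))
            = lead_minor d (fun i => Zentry x y (row_index s (r + i.+1))).
  by apply: eq_lead_minor => i _ c; rewrite shift.
have S2 d : lead_minor d (fun i => Zentry x y (row_index j.+1 (r + i)))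
          = lead_minor d (fun i => Zentry x y (row_index j (r + bump (p - r) i))).
  by apply: eq_lead_minor => i _ c; rewrite step_r.
have S3 d : lead_minor d (fun i => Zentry x y (row_index j.+1 (r + i.+1)))
          = lead_minor d (fun i => Zentry x y (row_index j (r + bump (p - r) i.+1))).
  by apply: eq_lead_minor => i _ c; rewrite step_r.
by rewrite !S1 !S2 S3 plucker //; lia.
Qed.

End Stages.

(** * Subtraction-free circuits *)

Definition dummy_gate := MkGate Add (Scalar, 1) (Scalar, 1).

Definition wf_operand (p q i : nat) (o : operand) : bool :=
  match o.1 with
  | VarX => o.2 < p | VarY => o.2 < q | Scalar => 0 < o.2 | Gate => o.2 < i
  end.

Definition wf_gate (p q i : nat) (g : gate) : bool :=
  [&& if gop g is Sub then false else true,
      wf_operand p q i (garg1 g) & wf_operand p q i (garg2 g)].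

Definition wf_gates (p q : nat) (gs : seq gate) : Prop :=
  forall i, i < size gs -> wf_gate p q i (nth dummy_gate gs i).

Lemma all_operands (P : pred operand) c :
  all P (operands c) =
  P (output c) && all (fun g => P (garg1 g) && P (garg2 g)) (gates c).
Proof.
case: c => gs o; rewrite /operands /=; congr (_ && _).
by elim: gs => //= g gs ->; rewrite andbA.
Qed.

Section WellFormed.
Variables (p q : nat).

Lemma all_wf_gates (P : pred gate) gs :
  wf_gates p q gs -> (forall i g, wf_gate p q i g -> P g) -> all P gs.
Proof.
by move=> gs_wf sub; apply/(all_nthP dummy_gate) => i /gs_wf /sub.
Qed.

Lemma wf_subtraction_free gs i :
  wf_gates p q gs -> subtraction_free (MkCircuit gs (Gate, i)).
Proof.
move=> gs_wf; rewrite /subtraction_free all_operands /=.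
apply/andP; split; apply: all_wf_gates gs_wf _ => j g /and3P[] //.
by move=> _ g1 g2; apply/andP; split; [move: g1|move: g2]; rewrite /wf_operand; case: (_.1).
Qed.

Lemma wf_inputs_in gs i :
  wf_gates p q gs -> inputs_in p q (MkCircuit gs (Gate, i)).
Proof.
move=> gs_wf; rewrite /inputs_in all_operands /=.
apply: all_wf_gates gs_wf _ => j g /and3P[_ g1 g2].
by apply/andP; split; [move: g1|move: g2]; rewrite /wf_operand; case: (_.1).
Qed.

Local Open Scope ring_scope.
Variables (F : fieldType) (x y : nat -> F).

(** A total counterpart of [eval_operand], with 0 for a missing gate, so that gate equations can be
    stated without options. *)
Definition operand_value (vals : seq F) (o : operand) : F :=
  match o.1 with
  | VarX => x o.2 | VarY => y o.2 | Scalar => o.2%:R | Gate => nth 0 vals o.2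
  end.

Definition arith_value (op : arith) (u v : F) : F :=
  match op with Add => u + v | Sub => u - v | Mul => u * v | Div => u / v end.

Definition gate_value (vals : seq F) (g : gate) : F :=
  arith_value (gop g) (operand_value vals (garg1 g))
    (operand_value vals (garg2 g)).

Variable P : F -> Prop.
Hypotheses (P_neq0 : forall u, P u -> u != 0)
  (P_add : forall u v, P u -> P v -> P (u + v))
  (P_mul : forall u v, P u -> P v -> P (u * v))
  (P_div : forall u v, P u -> P v -> P (u / v))
  (P_nat : forall i, (0 < i)%N -> P i%:R)
  (P_x : forall i, (i < p)%N -> P (x i)) (P_y : forall i, (i < q)%N -> P (y i)).

Lemma wf_operand_value vals o :
  (forall i, (i < size vals)%N -> P (nth 0 vals i)) ->
  wf_operand p q (size vals) o ->
  eval_operand x y vals o = Some (operand_value vals o)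
  /\ P (operand_value vals o).
Proof.
case: o => [[] i] Pvals; rewrite /wf_operand /eval_operand /operand_value /=; auto.
by move=> lt_i; split; [rewrite onthE (nth_map 0) | apply: Pvals].
Qed.

Lemma operand_value_rcons vals v o :
  wf_operand p q (size vals) o ->
  operand_value (rcons vals v) o = operand_value vals o.
Proof.
case: o => [[] i]; rewrite /wf_operand /operand_value //= => lt_i.
by rewrite nth_rcons lt_i.
Qed.

Lemma eval_gates_rcons vals gs g :
  eval_gates x y vals (rcons gs g) =
  obind (fun vals' => obind (fun v => Some (rcons vals' v)) (eval_gate x y vals' g))
    (eval_gates x y vals gs).
Proof.
elim: gs vals => [|g' gs IH] vals /=; first by case: (eval_gate _ _ _ _).
by case: (eval_gate _ _ _ _) => //= v; rewrite IH.
Qed.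

(** Divisions succeed because [P] excludes 0 and is preserved by every allowed operation. The last
    clause turns sequential evaluation into equations between entries of a single list. *)
Lemma eval_wf_gates gs : wf_gates p q gs ->
  exists vals, [/\ eval_gates x y [::] gs = Some vals, size vals = size gs,
    forall i, (i < size gs)%N -> P (nth 0 vals i) &
    forall i, (i < size gs)%N ->
      nth 0 vals i = gate_value vals (nth dummy_gate gs i)].
Proof.
elim/last_ind: gs => [|gs g IH] gs_wf; first by exists [::].
have [i lt_i|vals [evalE sizeE Pvals valsE]] := IH.
  have := gs_wf i; rewrite size_rcons nth_rcons lt_i; apply.
  exact: ltnW.
have := gs_wf (size gs); rewrite size_rcons nth_rcons ltnn eqxx ltnSn.
move=> /(_ isT) /and3P[op_ok g1 g2].
rewrite -sizeE in Pvals valsE g1 g2.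
have [eval1 P1] := wf_operand_value Pvals g1.
have [eval2 P2] := wf_operand_value Pvals g2.
have Pv : P (gate_value vals g).
  by rewrite /gate_value; case: (gop g) op_ok => //= _; auto.
exists (rcons vals (gate_value vals g)); split.
- rewrite eval_gates_rcons evalE /= /eval_gate eval1 eval2 /=.
  rewrite /gate_value; case: (gop g) op_ok => //= _.
  by rewrite (negPf (P_neq0 P2)).
- by rewrite !size_rcons sizeE.
- move=> i; rewrite -sizeE ltnS nth_rcons leq_eqVlt.
  by case: ltnP => [lt_i _|_]; [apply: Pvals | rewrite orbF => ->].
move=> i; rewrite -sizeE ltnS !nth_rcons -sizeE leq_eqVlt.
case: ltnP => [lt_i _|_]; last first.
  rewrite orbF => /eqP->; rewrite eqxx.
  by rewrite /gate_value !operand_value_rcons.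
have lt_i' : (i < size gs)%N by rewrite -sizeE.
have := gs_wf i; rewrite size_rcons ltnS (ltnW lt_i') nth_rcons lt_i'.
move=> /(_ isT) /and3P[_ w1 w2].
have lift o : wf_operand p q i o -> wf_operand p q (size vals) o.
  by case: o => [[] j]; rewrite /wf_operand //= => lt_ji; apply: ltn_trans lt_i.
by rewrite /gate_value !operand_value_rcons ?lift // valsE.
Qed.

End WellFormed.

(** * The circuit *)

Section Cells.
Variable lam : seq nat.

Definition width : nat := size lam + nth 0 lam 0.
(** The number of cells of one stage: [m] runs over 0, ..., k and [r] over 0, ..., n - 1. *)
Definition block : nat := (size lam + 1) * width.
Definition cell_count : nat := (nth 0 lam 0 + 1) * block.

Definition cell_output (g : nat) : operand := (Gate, 4 * g + 3).

(** The first three gates are padding that keeps all cells at length four. *)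
Definition copy_gates (o : operand) : seq gate :=
  nseq 4 (MkGate Mul (Scalar, 1) o).

(** With Q(m, r) the initial product, Q(m, r) = (x_{m-1} + y_{r-1}) Q(m, r-1) Q(m-1, r) / Q(m-1,
    r-1). *)
Definition product_gates (g m r : nat) : seq gate :=
  [:: MkGate Add (VarX, m - 1) (VarY, r - 1);
      MkGate Mul (Gate, 4 * g) (cell_output (g - 1));
      MkGate Mul (Gate, 4 * g + 1) (cell_output (g - width));
      MkGate Div (Gate, 4 * g + 2) (cell_output (g - (width + 1)))].

(** Subtracting [width] lowers [m] by one, subtracting [block] lowers [j] by one, and adding 1
    raises [r] by one. *)
Definition plucker_gates (g : nat) : seq gate :=
  [:: MkGate Mul (cell_output (g - width)) (cell_output (g - block + 1));
      MkGate Mul (cell_output (g - width + 1)) (cell_output (g - block));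
      MkGate Add (Gate, 4 * g) (Gate, 4 * g + 1);
      MkGate Div (Gate, 4 * g + 2) (cell_output (g - block - width + 1))].

(* Cell number [(j * (k + 1) + m) * n + r], where [k = size lam] and
   [n = width], computes [stage_minor lam j r m].  Each cell consists of exactly
   four gates, the last of which is its output.  Cells with [r + m + j > n] hold
   meaningless positive values. *)
Definition cell (g : nat) : seq gate :=
  let r := g %% width in
  let m := (g %/ width) %% (size lam + 1) in
  let j := g %/ block - 1 in
  if block - g != 0 then
    if r * m != 0 then product_gates g m r else copy_gates (Scalar, 1)
  else if nth 0 lam (size lam - 1 - r) - j != 0 then
    copy_gates (cell_output (g - block + 1))
  else if nth 0 lam (size lam - r - m) - j != 0 then plucker_gates g
  else copy_gates (cell_output (g - block)).

Definition cells (G : nat) : seq gate := flatten [seq cell g | g <- iota 0 G].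

Lemma size_cell g : size (cell g) = 4.
Proof. by rewrite /cell; do !case: ifP => _. Qed.

Lemma cellsS G : cells G.+1 = cells G ++ cell G.
Proof. by rewrite /cells -addn1 iotaD map_cat flatten_cat /= cats0. Qed.

Lemma size_cells G : size (cells G) = 4 * G.
Proof. by elim: G => // G IH; rewrite cellsS size_cat IH size_cell mulnS addnC. Qed.

Lemma nth_cells G g c : g < G -> c < 4 ->
  nth dummy_gate (cells G) (4 * g + c) = nth dummy_gate (cell g) c.
Proof.
move=> + lt_c4; elim: G => // G IH; rewrite cellsS nth_cat size_cells ltnS leq_eqVlt.
case/orP => [/eqP<-|lt_gG].
  by rewrite ltnNge leq_addr /= addKn.
by rewrite IH // ifT //; lia.
Qed.

Hypothesis k_gt0 : 0 < size lam.

Lemma width_gt0 : 0 < width. Proof. by rewrite /width; lia. Qed.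

(** Meaningless cells are included: all that matters is that references point backwards and
    variables are in range. *)
Lemma wf_cell g c : g < cell_count -> c < 4 ->
  wf_gate (size lam) width.-1 (4 * g + c) (nth dummy_gate (cell g) c).
Proof.
move=> lt_g lt_c; rewrite /cell.
have lt_r : g %% width < width by rewrite ltn_mod width_gt0.
have lt_m : (g %/ width) %% (size lam + 1) < size lam + 1 by rewrite ltn_mod addn1.
have copy_wf o : wf_operand (size lam) width.-1 (4 * g) o ->
    wf_gate (size lam) width.-1 (4 * g + c) (nth dummy_gate (copy_gates o) c).
  move=> o_wf; rewrite nth_nseq lt_c /wf_gate /=.
  by move: o_wf; case: o => [[] i]; rewrite /wf_operand //=; lia.
have le_wb : 2 * width <= block by rewrite leq_mul2r; lia.
have w_gt0 := width_gt0.
case: ifP => [lt_gb|/negbFE/eqP le_bg].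
  case: ifP => [rm_gt0|_]; last exact: copy_wf.
  have : 0 < g %/ width by move: rm_gt0; case: (g %/ width); rewrite ?mod0n ?muln0.
  rewrite divn_gt0 // => le_wg.
  move: rm_gt0; rewrite muln_eq0 => rm_gt0.
  by case: c lt_c {copy_wf} => [|[|[|[|]]]] // _; rewrite /wf_gate /wf_operand /=; lia.
(* A cell outside stage 0 exists only if the largest part is positive; then [g - width + 1] lies
   strictly before [g]. *)
have w_gt1 : 1 < width.
  have : 0 < nth 0 lam 0.
    by rewrite lt0n; apply: contraL lt_g => /eqP l0; rewrite /cell_count l0 mul1n; lia.
  by rewrite /width; lia.
case: ifP => _; first by apply: copy_wf; rewrite /wf_operand /=; lia.
case: ifP => _; last by apply: copy_wf; rewrite /wf_operand /=; lia.
by case: c lt_c {copy_wf} => [|[|[|[|]]]] // _; rewrite /wf_gate /wf_operand /=; lia.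
Qed.

Lemma wf_cells : wf_gates (size lam) width.-1 (cells cell_count).
Proof.
move=> i; rewrite size_cells => lt_i.
have lt_c : i %% 4 < 4 by rewrite ltn_mod.
have lt_g : i %/ 4 < cell_count by rewrite ltn_divLR // mulnC.
by rewrite (divn_eq i 4) mulnC nth_cells // wf_cell.
Qed.

End Cells.

(** * Decoding of cell numbers *)

Section CellIndex.
Variable lam : seq nat.
Let k := size lam.
Let n := width lam.

Definition cell_index (j m r : nat) : nat :=
  (j * (size lam + 1) + m) * width lam + r.

Variables (j m r : nat).
Hypotheses (le_mk : m <= k) (lt_rn : r < n).

Lemma cell_index_mod : cell_index j m r %% n = r.
Proof. by rewrite modnMDl modn_small. Qed.

Lemma cell_index_div : cell_index j m r %/ n = j * (k + 1) + m.
Proof. by rewrite divnMDl ?(leq_ltn_trans _ lt_rn) // divn_small ?addn0. Qed.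

Lemma cell_index_block : cell_index j m r %/ block lam = j.
Proof.
rewrite /block mulnC divnMA cell_index_div divnMDl ?addn1 // divn_small ?addn0 //.
Qed.

Lemma cell_cell_index :
  cell lam (cell_index j m r) =
  if j == 0 then
    if r * m != 0 then product_gates lam (cell_index j m r) m r
    else copy_gates (Scalar, 1)
  else if nth 0 lam (k - 1 - r) - j.-1 != 0 then
    copy_gates (cell_output (cell_index j m r - block lam + 1))
  else if nth 0 lam (k - r - m) - j.-1 != 0 then
    plucker_gates lam (cell_index j m r)
  else copy_gates (cell_output (cell_index j m r - block lam)).
Proof.
have b_gt0 : 0 < block lam.
  by rewrite muln_gt0 addn1 (leq_ltn_trans _ lt_rn).
rewrite /cell cell_index_mod cell_index_block cell_index_div modnMDl modn_small ?addn1 //.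
have -> : (block lam - cell_index j m r != 0) = (j == 0).
  by rewrite subn_eq0 -ltnNge -[X in _ < X]mul1n -ltn_divLR // cell_index_block ltnS leqn0.
by rewrite !subn1.
Qed.

Lemma cell_index_lt : j <= nth 0 lam 0 -> cell_index j m r < cell_count lam.
Proof.
have b_gt0 : 0 < block lam.
  by rewrite muln_gt0 addn1 (leq_ltn_trans _ lt_rn).
by rewrite /cell_count -ltn_divLR // cell_index_block addn1 ltnS.
Qed.

End CellIndex.

Lemma cell_index_pred lam j m r :
  cell_index lam j m.+1 r - width lam = cell_index lam j m r.
Proof. by rewrite /cell_index addnS mulSn addnAC -addnA addKn addnC. Qed.

Lemma cell_index_prev lam j m r :
  cell_index lam j.+1 m r - block lam = cell_index lam j m r.
Proof.
by rewrite /cell_index /block mulSn -(addnA (size lam + 1)) mulnDl -addnA addKn.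
Qed.

Lemma cell_indexS lam j m r : cell_index lam j m r.+1 = cell_index lam j m r + 1.
Proof. by rewrite addn1 /cell_index addnS. Qed.

(** * Values computed by the cells *)

Section CellValues.
Local Open Scope ring_scope.
Variables (F : fieldType) (x y : nat -> F) (lam : seq nat).
Hypotheses (lam_sorted : sorted geq lam) (k_gt0 : (0 < size lam)%N).
Hypothesis x_neq : forall a j, (a < j)%N -> (j < size lam)%N -> x j != x a.
Variable vals : seq F.
Let gs := cells lam (cell_count lam).
Hypothesis vals_neq0 : forall i, (i < size gs)%N -> nth 0 vals i != 0.
Hypothesis valsE : forall i, (i < size gs)%N ->
  nth 0 vals i = gate_value x y vals (nth dummy_gate gs i).

Definition cell_value (g : nat) : F := nth 0 vals (4 * g + 3).

Lemma cell_value_neq0 g : (g < cell_count lam)%N -> cell_value g != 0.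
Proof. by move=> lt_g; apply: vals_neq0; rewrite size_cells; lia. Qed.

Lemma valE g c : (g < cell_count lam)%N -> (c < 4)%N ->
  nth 0 vals (4 * g + c) = gate_value x y vals (nth dummy_gate (cell lam g) c).
Proof.
move=> lt_g lt_c; rewrite valsE ?nth_cells //.
by rewrite size_cells; lia.
Qed.

Lemma cell_value_copy g o : (g < cell_count lam)%N -> cell lam g = copy_gates o ->
  cell_value g = operand_value x y vals o.
Proof.
by move=> lt_g cellE; rewrite /cell_value valE // cellE /= /gate_value /= mul1r.
Qed.

Lemma cell_value_product g m r : (g < cell_count lam)%N ->
  cell lam g = product_gates lam g m r ->
  cell_value g = (x (m - 1) + y (r - 1)) * cell_value (g - 1)
    * cell_value (g - width lam) / cell_value (g - (width lam + 1)).
Proof.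
move=> lt_g cellE; have gateE c (lt_c : (c < 4)%N) := valE lt_g lt_c.
have [v0 v1 v2 v3] := And4 (gateE 0 isT) (gateE 1%N isT) (gateE 2 isT) (gateE 3 isT).
rewrite addn0 in v0; rewrite cellE /gate_value /operand_value /= in v0 v1 v2 v3.
by rewrite /cell_value v3 v2 v1 v0.
Qed.

Lemma cell_value_plucker g : (g < cell_count lam)%N ->
  cell lam g = plucker_gates lam g ->
  cell_value g =
  (cell_value (g - width lam) * cell_value (g - block lam + 1)
   + cell_value (g - width lam + 1) * cell_value (g - block lam))
  / cell_value (g - block lam - width lam + 1).
Proof.
move=> lt_g cellE; have gateE c (lt_c : (c < 4)%N) := valE lt_g lt_c.
have [v0 v1 v2 v3] := And4 (gateE 0 isT) (gateE 1%N isT) (gateE 2 isT) (gateE 3 isT).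
rewrite addn0 in v0; rewrite cellE /gate_value /operand_value /= in v0 v1 v2 v3.
by rewrite /cell_value v3 v2 v1 v0.
Qed.

(** Induction on [m], then on [r], along the recurrence of [product_gates]; on the borders [m = 0]
    and [r = 0] the product is 1. *)
Lemma cell_value_initial m r : (m <= size lam)%N -> (r < width lam)%N ->
  cell_value (cell_index lam 0 m r) = \prod_(j < m) \prod_(b < r) (x j + y b).
Proof.
elim: m r => [|m IHm] r le_m lt_r.
  rewrite big_ord0 (@cell_value_copy _ (Scalar, 1%N)) ?cell_index_lt //.
  by rewrite cell_cell_index //= muln0.
elim: r lt_r => [|r IHr] lt_r.
  rewrite (@cell_value_copy _ (Scalar, 1%N)) ?cell_index_lt //.
    by rewrite big1 // => j _; rewrite big_ord0.
  by rewrite cell_cell_index.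
rewrite (@cell_value_product _ m.+1 r.+1) ?cell_index_lt //; last first.
  by rewrite cell_cell_index.
(* The three cells read have indices (m+1, r), (m, r+1) and (m, r). *)
rewrite subnDA cell_index_pred ![cell_index _ _ _ r.+1]cell_indexS !addnK.
rewrite -cell_indexS IHr ?IHm //; try lia.
have := cell_value_neq0 (cell_index_lt (ltnW le_m) (ltnW lt_r) (leq0n _)).
rewrite IHm ?(ltnW le_m) ?(ltnW lt_r) // => Q_neq0.
rewrite !big_ord_recr /= !subn1 /=.
by field.
Qed.

(** Induction on [j], then on [m]. The bound on [r + m + j] passes to every entry read: [r] grows by
    one only when [j] or [m] drops by one. *)
Lemma cell_value_stage j m r : (0 < m <= size lam)%N -> (j <= nth 0 lam 0)%N ->
  (r + m + j <= width lam)%N ->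
  cell_value (cell_index lam j m r) = stage_minor x y lam j r m.
Proof.
elim: j m r => [|j IHj] m r /andP[m_gt0 le_m] le_j bound.
  rewrite cell_value_initial //; last by lia.
  by rewrite stage_minor0 // => a c lt_a lt_c; apply: x_neq; lia.
elim: m m_gt0 r le_m bound => // m IHm _ r le_m bound.
have lt_r : (r < width lam)%N by lia.
have lt_g : (cell_index lam j.+1 m.+1 r < cell_count lam)%N by apply: cell_index_lt.
have := cell_cell_index j.+1 le_m lt_r; rewrite /= cell_index_prev -cell_indexS.
case: ifP => [lt_j|/negbFE lt_j] cellE.
  rewrite (cell_value_copy lt_g cellE) [LHS]IHj ?stage_minor_after //; try lia.
  by rewrite -subn1; lia.
move: cellE; case: ifP => [lt_j'|/negbFE lt_j'] cellE; last first.
  rewrite (cell_value_copy lt_g cellE) [LHS]IHj ?stage_minor_before //; lia.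
have [|m_gt1] := @stage_minor_across F x y lam lam_sorted j r m.+1 isT.
  by rewrite -subn1; lia.
rewrite /= => plucker.
rewrite (cell_value_plucker lt_g cellE) cell_index_prev cell_index_pred.
rewrite cell_index_pred -!cell_indexS.
have Dneq0 : cell_value (cell_index lam j m r.+1) != 0.
  by apply/cell_value_neq0/cell_index_lt; lia.
rewrite !IHm ?IHj // in Dneq0 *; try lia.
by rewrite -plucker mulrC mulKf.
Qed.

Lemma cell_value_output :
  cell_value (cell_index lam (nth 0 lam 0) (size lam) 0) = double_schur lam x y.
Proof.
by rewrite cell_value_stage ?stage_minor_full ?k_gt0 /=.
Qed.

End CellValues.

(** * The generating program *)

Lemma ltn_bitlen m : m < 2 ^ bitlen m.
Proof. exact: trunc_log_ltn. Qed.

Lemma bitlen_le m b : 0 < b -> m < 2 ^ b -> bitlen m <= b.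
Proof.
case: b => // b _ lt_m; rewrite /bitlen ltnS -ltnS.
have [->|m_gt0] := posnP m; first by rewrite trunc_log0.
by rewrite -(@ltn_exp2l 2) // (leq_ltn_trans (trunc_logP _ m_gt0)).
Qed.

Lemma leq_bitlen u v : u <= v -> bitlen u <= bitlen v.
Proof. by move=> le_uv; rewrite ltnS leq_trunc_log. Qed.

Lemma bitlenM u v : bitlen (u * v) <= bitlen u + bitlen v.
Proof. by apply: bitlen_le; rewrite // expnD ltn_mul ?ltn_bitlen. Qed.

Lemma bitlenD u v : bitlen (u + v) <= bitlen u + bitlen v.
Proof.
apply: bitlen_le => //; have := ltn_bitlen u; have := ltn_bitlen v.
have := expn_gt0 2 (trunc_log 2 u); have := expn_gt0 2 (trunc_log 2 v).
by rewrite /bitlen addSn addnS !expnS expnD; nia.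
Qed.

Lemma bitlen_arith op u v : bitlen (nat_arith op u v) <= bitlen u + bitlen v.
Proof.
case: op => /=; [exact: bitlenD| | exact: bitlenM|].
  by apply: leq_trans (leq_addr _ _); apply/leq_bitlen/leq_subr.
by apply: leq_trans (leq_addr _ _); apply/leq_bitlen/leq_div.
Qed.

(** When memory words have at most L bits, values of expressions have O(L) bits and evaluating them
    costs O(L^2); this and the next function give the constants. *)
Fixpoint expr_size_const (e : expr) : nat :=
  match e with
  | Lit v => bitlen v
  | Get _ _ => 1
  | Op _ e1 e2 => expr_size_const e1 + expr_size_const e2
  end.

Fixpoint expr_cost_const (e : expr) : nat :=
  match e with
  | Lit v => bitlen v
  | Get _ e1 => expr_cost_const e1 + expr_size_const e1 + 1
  | Op _ e1 e2 => expr_cost_const e1 + expr_cost_const e2 +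
      (expr_size_const e1 + expr_size_const e2
       + expr_size_const e1 * expr_size_const e2)
  end.

Lemma arith_cost_le op c d L u v : u <= c * L -> v <= d * L ->
  arith_cost op u v <= (c + d + c * d) * L ^ 2.
Proof.
move=> le_u le_v; case: L le_u le_v => [|L] le_u le_v.
  by move: le_u le_v; rewrite !muln0 !leqn0 => /eqP-> /eqP->; case: op.
have uv : u * v <= c * d * L.+1 ^ 2 by rewrite -mulnn mulnACA leq_mul.
have sq : L.+1 <= L.+1 ^ 2 by rewrite -mulnn leq_pmulr.
have : (c + d) * L.+1 <= (c + d) * L.+1 ^ 2 by rewrite leq_mul2l sq orbT.
by case: op; rewrite /arith_cost mulnDl; lia.
Qed.

Section BoundedMemory.
Variables (mem : memory) (L : nat).
Hypotheses (L_gt0 : 0 < L) (memL : forall a i, bitlen (mem a i) <= L).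

Lemma leq_sqr : L <= L ^ 2. Proof. by rewrite -mulnn leq_pmulr. Qed.

Lemma bitlen_eval e : bitlen (eval mem e) <= expr_size_const e * L.
Proof.
elim: e => [v|a e _|op e1 IH1 e2 IH2] /=; first by rewrite leq_pmulr.
  by rewrite mul1n.
by apply: leq_trans (bitlen_arith _ _ _) _; rewrite mulnDl leq_add.
Qed.

Lemma bitlen_eval_sqr e : bitlen (eval mem e) <= expr_size_const e * L ^ 2.
Proof.
by apply: leq_trans (bitlen_eval e) _; rewrite leq_mul2l leq_sqr orbT.
Qed.

Lemma ecost_le e : ecost mem e <= expr_cost_const e * L ^ 2.
Proof.
elim: e => [v|a e IH|op e1 IH1 e2 IH2] /=.
- by rewrite leq_pmulr // expn_gt0 L_gt0.
- have := bitlen_eval_sqr e; have := memL a (eval mem e); have := leq_sqr.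
  by rewrite !mulnDl mul1n; lia.
rewrite mulnDl leq_add // ?arith_cost_le ?bitlen_eval //.
by rewrite mulnDl leq_add.
Qed.

(** Such programs neither loop nor write to memory, so the gates they emit depend on the initial
    memory alone. *)
Fixpoint emit_only (p : cmd) : bool :=
  match p with
  | Seq p1 p2 | If _ p1 p2 => emit_only p1 && emit_only p2
  | Emit _ _ _ _ _ => true
  | _ => false
  end.

Fixpoint emitted (p : cmd) : seq gate :=
  match p with
  | Seq p1 p2 => emitted p1 ++ emitted p2
  | If e p1 p2 => if eval mem e != 0 then emitted p1 else emitted p2
  | Emit op s1 e1 s2 e2 => [:: MkGate op (s1, eval mem e1) (s2, eval mem e2)]
  | _ => [::]
  end.

(** Both branches of a conditional are counted, which makes the constant independent of the
    memory. *)
Fixpoint emit_const (p : cmd) : nat :=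
  match p with
  | Seq p1 p2 => emit_const p1 + emit_const p2
  | If e p1 p2 => expr_cost_const e + expr_size_const e
      + (emit_const p1 + emit_const p2)
  | Emit _ _ e1 _ e2 => expr_cost_const e1 + expr_cost_const e2
      + expr_size_const e1 + expr_size_const e2 + 1
  | _ => 0
  end.

Lemma exec_emit_only p c : emit_only p ->
  bitlen (size (gates c) + size (emitted p)) <= L ->
  exists t, exec p (mem, c) t (mem, MkCircuit (gates c ++ emitted p) (output c))
    /\ t <= emit_const p * L ^ 2.
Proof.
elim: p c => // [p1 IH1 p2 IH2|e p1 IH1 p2 IH2|op s1 e1 s2 e2] [gs o] /=.
- move=> /andP[p1_ok p2_ok]; rewrite size_cat => leL.
  have [|t1 [ex1 le1]] := IH1 (MkCircuit gs o) p1_ok.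
    by apply: leq_trans leL; apply: leq_bitlen; rewrite addnA leq_addr.
  have [|t2 [ex2 le2]] := IH2 (MkCircuit (gs ++ emitted p1) o) p2_ok.
    by rewrite /= size_cat -addnA.
  exists (t1 + t2); split; last by rewrite mulnDl leq_add.
  by apply: ExecSeq ex1 _; rewrite catA.
- move=> /andP[p1_ok p2_ok] leL.
  have := bitlen_eval_sqr e; have := ecost_le e => le_c le_b.
  case: (eqVneq (eval mem e) 0) leL => [e0|e_neq0] /= leL.
    have [|t [ex le_t]] := IH2 (MkCircuit gs o) p2_ok => //.
    exists (ecost mem e + bitlen (eval mem e) + t); split; first exact: ExecIfFalse.
    by rewrite !mulnDl; lia.
  have [|t [ex le_t]] := IH1 (MkCircuit gs o) p1_ok => //.
  exists (ecost mem e + bitlen (eval mem e) + t); split; first exact: ExecIfTrue.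
  by rewrite !mulnDl; lia.
move=> _ leL; eexists; split; first by rewrite cats1; apply: ExecEmit.
have := bitlen_eval_sqr e1; have := ecost_le e1; have := bitlen_eval_sqr e2.
have := ecost_le e2; have := leq_sqr.
have : bitlen (circuit_size (MkCircuit gs o)) <= L.
  by apply: leq_trans leL; apply: leq_bitlen; rewrite leq_addr.
by rewrite !mulnDl mul1n; lia.
Qed.

End BoundedMemory.

(** * The program that writes the circuit *)

Definition e_k := Get 0 (Lit 0).
Definition e_part (e : expr) := Get 1 e.
(** The counter of the main loop, initially 0 and the only memory cell that the program changes. *)
Definition e_cell := Get 2 (Lit 0).
Definition e_width := Op Add e_k (e_part (Lit 0)).
Definition e_block := Op Mul (Op Add e_k (Lit 1)) e_width.
Definition e_count := Op Mul (Op Add (e_part (Lit 0)) (Lit 1)) e_block.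
Definition e_mod (e d : expr) := Op Sub e (Op Mul (Op Div e d) d).
Definition e_row := e_mod e_cell e_width.
Definition e_size := e_mod (Op Div e_cell e_width) (Op Add e_k (Lit 1)).
Definition e_step := Op Sub (Op Div e_cell e_block) (Lit 1).
Definition e_gate (e : expr) (c : nat) := Op Add (Op Mul (Lit 4) e) (Lit c).
Definition e_output (e : expr) := e_gate e 3.

Definition emit4 (p1 p2 p3 p4 : cmd) := Seq p1 (Seq p2 (Seq p3 p4)).

Definition emit_copy (s : source) (e : expr) :=
  let p := Emit Mul Scalar (Lit 1) s e in emit4 p p p p.

Definition emit_product :=
  emit4
    (Emit Add VarX (Op Sub e_size (Lit 1)) VarY (Op Sub e_row (Lit 1)))
    (Emit Mul Gate (Op Mul (Lit 4) e_cell)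
       Gate (e_output (Op Sub e_cell (Lit 1))))
    (Emit Mul Gate (e_gate e_cell 1) Gate (e_output (Op Sub e_cell e_width)))
    (Emit Div Gate (e_gate e_cell 2)
       Gate (e_output (Op Sub e_cell (Op Add e_width (Lit 1))))).

Definition emit_plucker :=
  let below := Op Sub e_cell e_width in
  let previous := Op Sub e_cell e_block in
  emit4
    (Emit Mul Gate (e_output below) Gate (e_output (Op Add previous (Lit 1))))
    (Emit Mul Gate (e_output (Op Add below (Lit 1))) Gate (e_output previous))
    (Emit Add Gate (Op Mul (Lit 4) e_cell) Gate (e_gate e_cell 1))
    (Emit Div Gate (e_gate e_cell 2)
       Gate (e_output (Op Add (Op Sub previous e_width) (Lit 1)))).

Definition emit_cell :=
  If (Op Sub e_block e_cell)
    (If (Op Mul e_row e_size) emit_product (emit_copy Scalar (Lit 1)))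
    (If (Op Sub (e_part (Op Sub (Op Sub e_k (Lit 1)) e_row)) e_step)
       (emit_copy Gate (e_output (Op Add (Op Sub e_cell e_block) (Lit 1))))
       (If (Op Sub (e_part (Op Sub (Op Sub e_k e_row) e_size)) e_step)
          emit_plucker
          (emit_copy Gate (e_output (Op Sub e_cell e_block))))).

Definition e_next := Op Add e_cell (Lit 1).
Definition e_continue := Op Sub e_count e_cell.

Definition cell_loop := While e_continue (Seq emit_cell (Store 2 (Lit 0) e_next)).

Definition e_final :=
  e_output (Op Mul (Op Add (Op Mul (e_part (Lit 0)) (Op Add e_k (Lit 1))) e_k)
              e_width).

Definition program := Seq cell_loop (Output Gate e_final).

Section Execution.
Variable lam : seq nat.

Definition loop_memory (g : nat) : memory :=
  fun a i => match a, i with 2, 0 => g | _, _ => input_memory lam a i end.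

Lemma subn_divn m d : m - m %/ d * d = m %% d.
Proof. by rewrite {1}(divn_eq m d) addKn. Qed.

(** The tests in [cell] are nonzero truncated differences and products, just like the conditions of
    the program, so only the remainders need rewriting. *)
Lemma emitted_cell mem g : mem =2 loop_memory g -> emitted mem emit_cell = cell lam g.
Proof.
move=> memE; rewrite /cell -!subn_divn.
by rewrite /emit_cell /= !memE.
Qed.

Definition continue_const := expr_cost_const e_continue + expr_size_const e_continue.

Definition iteration_const :=
  continue_const + emit_const emit_cell
  + (expr_cost_const (Lit 0) + expr_cost_const e_next
     + expr_size_const (Lit 0) + expr_size_const e_next).

Definition output_const := expr_cost_const e_final + expr_size_const e_final.

Variable L : nat.
Hypotheses (L_gt0 : 0 < L)
  (memL : forall g a i, g <= cell_count lam -> bitlen (loop_memory g a i) <= L)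
  (sizeL : bitlen (4 * cell_count lam) <= L).

(** Induction on the number [d] of cells still to be written. Memories are compared pointwise
    because [update] builds new functions. *)
Lemma exec_cell_loop d g mem gs o :
  g + d = cell_count lam -> mem =2 loop_memory g -> size gs = 4 * g ->
  exists t mem',
  [/\ exec cell_loop (mem, MkCircuit gs o) t
        (mem', MkCircuit (gs ++ flatten [seq cell lam i | i <- iota g d]) o),
      mem' =2 loop_memory (cell_count lam) &
      t <= (d * iteration_const + continue_const) * L ^ 2].
Proof.
elim: d g mem gs => [|d IH] g mem gs gd memE size_gs.
  rewrite addn0 in gd; subst g; exists (ecost mem e_continue + bitlen (eval mem e_continue)), mem.
  split=> //.
    rewrite cats0; apply: ExecWhileFalse.
    by rewrite /= !memE /= subnn.
  rewrite mul0n add0n /continue_const mulnDl.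
  by rewrite leq_add ?ecost_le ?bitlen_eval_sqr // => a i; rewrite memE memL.
have memL' a i : bitlen (mem a i) <= L by rewrite memE memL //; lia.
have go : eval mem e_continue != 0.
  by rewrite /= !memE /= -/(width lam) -/(block lam) -/(cell_count lam) -gd; lia.
have cellE := emitted_cell memE.
have [|t1 [ex1 le1]] := @exec_emit_only mem L L_gt0 memL' emit_cell (MkCircuit gs o) isT.
  rewrite cellE size_cell /= size_gs; apply: leq_trans sizeL.
  by apply: leq_bitlen; rewrite -gd; lia.
rewrite cellE /= in ex1.
set mem1 := update mem 2 0 (g + 1).
have mem1E : mem1 =2 loop_memory g.+1.
  move=> a i; rewrite /mem1 /update addn1.
  case: eqP => [->|ne_a] /=; last by rewrite memE; case: a ne_a => [|[|[|a]]].
  by case: eqP => [->|ne_i] //=; rewrite memE; case: i ne_i.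
have [|||t2 [mem2 [ex2 mem2E le2]]] := IH g.+1 mem1 (gs ++ cell lam g) => //.
- by rewrite addSnnS.
- by rewrite size_cat size_cell size_gs mulnS addnC.
pose t3 := ecost mem (Lit 0) + ecost mem e_next + bitlen (eval mem (Lit 0))
           + bitlen (eval mem e_next).
exists (ecost mem e_continue + bitlen (eval mem e_continue) + (t1 + t3) + t2), mem2.
split=> //.
  rewrite /= catA; apply: ExecWhileTrue ex2 => //; apply: ExecSeq ex1 _.
  rewrite (_ : mem1 = update mem 2 (eval mem (Lit 0)) (eval mem e_next)); last first.
    by rewrite /mem1 /= memE.
  exact: ExecStore.
have bound e := conj (ecost_le L_gt0 memL' e) (bitlen_eval_sqr L_gt0 memL' e).
have := bound e_continue; have := bound (Lit 0); have := bound e_next.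
move: le1 le2; rewrite /t3 mulSn /iteration_const /continue_const.
move: (L ^ 2) => L2.
move: (ecost _ _) (ecost _ (Lit 0)) (ecost _ e_next) => ? ? ?.
rewrite !mulnDl; lia.
Qed.

Lemma generates_cells :
  exists t,
  [/\ generates program lam t
        (MkCircuit (cells lam (cell_count lam))
           (cell_output (cell_index lam (nth 0 lam 0) (size lam) 0))) &
      t <= (cell_count lam * iteration_const + continue_const + output_const) * L ^ 2].
Proof.
have mem0E : input_memory lam =2 loop_memory 0 by case=> [|[|[|a]]] [|i].
have [||t [mem [ex memE le_t]]] :=
  @exec_cell_loop (cell_count lam) 0 (input_memory lam) [::] (Gate, 0) _ mem0E => //.
exists (t + (ecost mem e_final + bitlen (eval mem e_final))); split.
  exists mem; apply: ExecSeq ex _.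
  have -> : cell_output (cell_index lam (nth 0 lam 0) (size lam) 0)
          = (Gate, eval mem e_final).
    by rewrite /= !memE /= /cell_output /cell_index addn0.
  exact: ExecOutput.
rewrite mulnDl leq_add // /output_const mulnDl.
by rewrite leq_add ?ecost_le ?bitlen_eval_sqr // => a i; rewrite memE memL.
Qed.

End Execution.

(** * Rational functions positive at (1, ..., 1) *)

Section PositiveFractions.
Import Order.TTheory Num.Theory.
Local Open Scope ring_scope.
Variable N : nat.

Definition at_ones (u : {mpoly int[N]}) : int := u.@[fun=> 1].

(** Evaluation at a point is a ring morphism, so this class is closed under sums, products and
    quotients; it serves as the predicate [P] of [eval_wf_gates]. *)
Definition positive_fraction (f : {fraction {mpoly int[N]}}) : Prop :=
  exists u v, [/\ f = tofrac u / tofrac v, 0 < at_ones u & 0 < at_ones v].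

Lemma tofrac_positive_neq0 u : 0 < at_ones u -> tofrac u != 0.
Proof.
move=> u_gt0; rewrite tofrac_eq0; apply: contraTneq u_gt0 => ->.
by rewrite /at_ones meval0 ltxx.
Qed.

Lemma positive_fraction_neq0 f : positive_fraction f -> f != 0.
Proof.
move=> [u [v [-> u_gt0 v_gt0]]].
by rewrite mulf_neq0 ?invr_neq0 ?tofrac_positive_neq0.
Qed.

Lemma positive_fractionD f g :
  positive_fraction f -> positive_fraction g -> positive_fraction (f + g).
Proof.
move=> [u [v [-> u_gt0 v_gt0]]] [u' [v' [-> u'_gt0 v'_gt0]]].
exists (u * v' + u' * v), (v * v'); rewrite /at_ones mevalD !mevalM.
split; last by rewrite mulr_gt0.
  by rewrite addf_div ?tofrac_positive_neq0 // !(tofracD, tofracM).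
by rewrite addr_gt0 // mulr_gt0.
Qed.

Lemma positive_fractionM f g :
  positive_fraction f -> positive_fraction g -> positive_fraction (f * g).
Proof.
move=> [u [v [-> u_gt0 v_gt0]]] [u' [v' [-> u'_gt0 v'_gt0]]].
exists (u * u'), (v * v'); rewrite /at_ones !mevalM !mulr_gt0 //.
by rewrite mulf_div !tofracM.
Qed.

Lemma positive_fractionV f : positive_fraction f -> positive_fraction f^-1.
Proof. by move=> [u [v [-> u_gt0 v_gt0]]]; exists v, u; rewrite invf_div. Qed.

Lemma positive_fraction_div f g :
  positive_fraction f -> positive_fraction g -> positive_fraction (f / g).
Proof. by move=> ? ?; apply/positive_fractionM/positive_fractionV. Qed.

Lemma positive_tofrac u : 0 < at_ones u -> positive_fraction (tofrac u).
Proof. by exists u, 1; rewrite tofrac1 divr1 /at_ones meval1. Qed.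

Lemma positive_fraction_nat i : (0 < i)%N -> positive_fraction i%:R.
Proof.
move=> i_gt0; rewrite -[1]tofrac1 -tofracMn; apply: positive_tofrac.
by rewrite /at_ones mevalMn meval1 ltr0n.
Qed.

Lemma fvarE i (lt_i : (i < N)%N) : fvar N i = tofrac 'X_(Ordinal lt_i).
Proof. by rewrite /fvar insubT. Qed.

Lemma positive_fvar i : (i < N)%N -> positive_fraction (fvar N i).
Proof.
move=> lt_i; rewrite fvarE; apply: positive_tofrac.
by rewrite /at_ones mevalXU.
Qed.

(** Evaluating variable number [a] at the integer [a] separates the variables. *)
Lemma fvar_inj i j : (i < N)%N -> (j < N)%N -> fvar N i = fvar N j -> i = j.
Proof.
move=> lt_i lt_j; rewrite !fvarE => /eqP; rewrite tofrac_eq => /eqP.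
move/(congr1 (meval (fun a : 'I_N => (a : nat)%:R : int))).
by rewrite !mevalXU => /eqP; rewrite eqr_nat => /eqP.
Qed.

End PositiveFractions.

(** * Cost estimates and conclusion *)

Lemma perform_cost_le L c : perform_cost L c <= circuit_size c * (2 * L + L ^ 2).
Proof.
rewrite /perform_cost /circuit_size -sum1_size big_distrl /=.
apply: leq_sum => g _; rewrite mul1n -mulnn.
by case: (gop g); rewrite /arith_cost; lia.
Qed.

Lemma cell_count_le lam : 0 < size lam -> cell_count lam <= 2 * width lam ^ 3.
Proof.
move=> k_gt0; rewrite /cell_count /block /width.
move: (nth 0 lam 0) (size lam) k_gt0 => l k k_gt0.
(* The three factors bound [l + 1], [k + 1] and the width. *)
have -> : 2 * (k + l) ^ 3 = (k + l) * ((2 * (k + l)) * (k + l)) by ring.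
by rewrite leq_mul ?leq_mul //; lia.
Qed.

Lemma bitlen_cube c n : bitlen (c * n ^ 3) <= bitlen c + 3 * bitlen n.
Proof.
apply: leq_trans (bitlenM _ _) _; rewrite leq_add2l !expnS muln1.
do 2!(apply: leq_trans (bitlenM _ _) _; rewrite mulSn leq_add2l).
by rewrite mul1n.
Qed.

(** The same quantity bounds the number of gates, so one word length serves for memory and gate
    numbers. *)
Lemma loop_memory_le lam g a i : sorted geq lam -> 0 < size lam ->
  g <= cell_count lam -> loop_memory lam g a i <= 8 * width lam ^ 3.
Proof.
move=> lam_sorted k_gt0 le_g.
have le_cube : width lam <= 8 * width lam ^ 3.
  have : 0 < width lam by apply: width_gt0.
  rewrite !expnS; nia.
have le_part : nth 0 lam i <= 8 * width lam ^ 3.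
  apply: leq_trans le_cube; apply: leq_trans (leq_addl _ _).
  exact: nth_part_le.
have := cell_count_le k_gt0; case: a => [|[|[|a]]] //=; case: i le_part => [|i] //= le_part le_c.
  by apply: leq_trans le_cube; apply: leq_addr.
by lia.
Qed.

Theorem theorem2p4 :
  exists (C : nat) (p : cmd),
  forall a : nat, exists D : nat,
  forall (k : nat) (lam : seq nat),
    1 <= k -> size lam = k -> sorted geq lam ->
    let n := k + nth 0 lam 0 in
    let N := k + n.-1 in
    let x := fun j => fvar N j in
    let y := fun b => fvar N (k + b) in
    exists (t : nat) (c : circuit),
      generates p lam t c /\
      subtraction_free c /\
      inputs_in k n.-1 c /\
      eval_circuit x y c = Some (double_schur lam x y) /\
      circuit_size c <= C * n ^ 3 /\
      t + perform_cost (a * bitlen n) c <= D * (n ^ 3 * bitlen n ^ 2).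
Proof.
(* Four gates for each of at most 2 n^3 cells. *)
exists 8, program => a.
(* The first summand pays for generation with words of [7 * bitlen n] bits, whence 49, and the
   second for performing at most 8 n^3 gates. *)
exists (49 * (2 * iteration_const + continue_const + output_const) + 8 * (2 * a + a ^ 2)).
move=> k lam k_gt0 size_lam lam_sorted n N x y; subst k.
have nE : n = width lam by [].
have n_gt0 : 0 < n by rewrite nE width_gt0.
have L_gt0 : 0 < 7 * bitlen n by [].
have le_count : cell_count lam <= 2 * n ^ 3 by rewrite nE cell_count_le.
(* The factor 8 contributes 4 bits and the cube [3 * bitlen n]. *)
have bit8 : bitlen (8 * n ^ 3) <= 7 * bitlen n.
  apply: leq_trans (bitlen_cube _ _) _.
  by rewrite (_ : bitlen 8 = 4) // (_ : 7 = 4 + 3) // mulnDl leq_add2r leq_pmulr.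
have [||t [gen_t le_t]] := @generates_cells lam (7 * bitlen n) L_gt0.
- move=> g b i le_g; apply: leq_trans bit8; apply: leq_bitlen.
  by rewrite nE loop_memory_le.
- by apply: leq_trans bit8; apply: leq_bitlen; lia.
have wf := wf_cells k_gt0.
exists t, (MkCircuit (cells lam (cell_count lam))
  (cell_output (cell_index lam (nth 0 lam 0) (size lam) 0))).
have sizeE : size (cells lam (cell_count lam)) = 4 * cell_count lam := size_cells _ _.
have le_size : 4 * cell_count lam <= 8 * n ^ 3 by lia.
split; first exact: gen_t.
split; first exact: wf_subtraction_free wf.
split; first by have := wf_inputs_in _ wf; rewrite -nE; apply.
split.
  have P_x i : i < size lam -> positive_fraction (x i).
    by move=> lt_i; apply: positive_fvar; rewrite /N; lia.
  have P_y i : i < n.-1 -> positive_fraction (y i).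
    by move=> lt_i; apply: positive_fvar; rewrite /N ltn_add2l.
  have [vals [evalE size_vals Pvals valsE]] :=
    eval_wf_gates (@positive_fraction_neq0 N) (@positive_fractionD N)
      (@positive_fractionM N) (@positive_fraction_div N)
      (@positive_fraction_nat N) P_x P_y wf.
  rewrite /eval_circuit evalE /= /eval_operand /=.
  (* Distinctness of the variables keeps the denominators of [Zentry] nonzero. *)
  have x_neq i j : i < j -> j < size lam -> x j != x i.
    move=> lt_ij lt_j; have lt_jN : j < N by apply: ltn_addr.
    apply/eqP => /(fvar_inj lt_jN (ltn_trans lt_ij lt_jN)) eq_ji.
    by move: lt_ij; rewrite eq_ji ltnn.
  have lt_out : cell_index lam (nth 0 lam 0) (size lam) 0 < cell_count lam.
    by rewrite cell_index_lt // width_gt0.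
  rewrite onthE (nth_map 0%R) ?size_vals ?sizeE; last by lia.
  congr Some; apply: (cell_value_output lam_sorted k_gt0 x_neq) => // i lt_i.
  exact/positive_fraction_neq0/Pvals.
split; first by rewrite /circuit_size /= sizeE.
have := perform_cost_le (a * bitlen n)
  (MkCircuit (cells lam (cell_count lam)) (cell_output (cell_index lam (nth 0 lam 0) (size lam) 0))).
rewrite /circuit_size /= sizeE => le_perform.
rewrite mulnDl leq_add //.
  apply: leq_trans le_t _; rewrite expnMn (_ : 7 ^ 2 = 49) //.
  rewrite [leqLHS]mulnCA -[leqRHS]mulnA leq_mul2l /= mulnA leq_mul2r; apply/orP; right.
  have : 0 < n ^ 3 by rewrite expn_gt0 n_gt0.
  by nia.
apply: leq_trans le_perform _.
rewrite -[leqRHS]mulnA [_ * (n ^ 3 * _)]mulnCA [leqRHS]mulnA leq_mul //.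
by rewrite expnMn mulnDl leq_add2r mulnA leq_mul2l -mulnn leq_pmulr ?orbT.
Qed.
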